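(* There is an absolute constant $C>0$ such that for every positive integer $n$ and every set $B$ of $n$ complex numbers, every arithmetic progression (with nonzero common difference) contained in the product set $B.B=\{bb' : b,b'\in B\}$ has length at most $C\, n^{3/2}$.
   Context: The length of an arithmetic progression is its number of terms. *)

(* Defs.v *)
From HB Require Import structures.
From mathcomp Require Import all_boot all_order all_algebra.
From mathcomp Require Import finmap complex.
From mathcomp Require Import reals exp.

Set Implicit Arguments.
Unset Strict Implicit.
Unset Printing Implicit Defensive.

Import Order.TTheory GRing.Theory Num.Theory.

Local Open Scope fset_scope.
Local Open Scope ring_scope.

Definition prodset (K : pzSemiRingType) (B : {fset K}) : {fset K} :=
  [fset b * b' | b in B, b' in B].

(* The k terms a, a + d, ..., a + (k - 1) d. *)
Definition arith_prog (V : nmodType) (a d : V) (k : nat) : seq V :=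
  mkseq (fun i => a + d *+ i) k.

(* Main.v *)
Require Import Defs.
From HB Require Import structures.
From mathcomp Require Import all_boot all_order all_algebra.
From mathcomp Require Import finmap complex.
From mathcomp Require Import reals exp.
From mathcomp Require Import zify ring lra.

Set Implicit Arguments.
Unset Strict Implicit.
Unset Printing Implicit Defensive.

Import Order.TTheory GRing.Theory Num.Theory.

(** Regard the [k] terms of the progression as edges of a bipartite graph
    between two copies of [B]. If [k] exceeds a multiple of [n^(3/2)], the graph
    contains a 4-cycle, hence a relation
    [(a + d i) (a + d l) = (a + d j) (a + d h)] with [i] different from [j] and
    [h]; this forces [a / d] to be rational, so the terms are [c (s + t i)] with
    [s] and [t] coprime integers.

    Take [m = 30 (n + 2)] consecutive terms at the end of the progression where
    [|s + t i|] is about [U >= (k - 1) / 2]. A prime [p < m] contributes to the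
    product of these integers at most its contribution to [m!] times the largest
    power of [p] in a single term, so by size at least [m / 3 - pi(m)] of the
    terms have a prime factor [p >= m]; since [pi(m) <= 4 m / 15 + 3], that is
    more than [n + 1]. Such a prime divides no other term, so these terms are
    multiplicatively independent, whereas any [n + 2] integers [x] with all
    [c x] in [B.B] satisfy a nontrivial multiplicative relation. *)

(** * Counting primes through the residues coprime to 30 *)

Lemma prime_coprime30 p : prime p -> 5 < p -> coprime p 30.
Proof.
move=> pp p5.
have -> : 30 = 2 * (3 * 5) by [].
rewrite !coprimeMr !(coprime_sym p) !prime_coprime // !dvdn_prime2 //.
by apply/and3P; split; apply/eqP; lia.
Qed.

Lemma sum_coprime30 q : \sum_(0 <= i < 30 * q) coprime i 30 = 8 * q.
Proof.
elim: q => [|q IHq]; first by rewrite !muln0 big_geq.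
rewrite mulnS addnC (@big_cat_nat _ _ _ (30 * q)) /= ?leq_addr // IHq.
rewrite -[X in \sum_(X <= _ < _) _]add0n big_addn.
have -> : 30 * q + 30 - 30 * q = 30 by lia.
rewrite mulnS addnC; congr addn.
have E i : coprime (i + 30 * q) 30 = coprime i 30.
  by rewrite -coprime_modl addnC mulnC modnMDl coprime_modl.
under eq_bigr do rewrite E.
by rewrite unlock.
Qed.

(** Every prime above 5 is coprime to 30, and each block of 30 integers has 8 such residues; the
    constant absorbs 2, 3 and 5. *)
Lemma sum_prime_leq q : \sum_(0 <= p < 30 * q) prime p <= 8 * q + 3.
Proof.
case: q => [|q]; first by rewrite big_geq.
have l6 : 6 <= 30 * q.+1 by lia.
rewrite -sum_coprime30 !(@big_cat_nat _ _ _ 6 0 (30 * q.+1)) //=.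
have -> : \sum_(0 <= i < 6) prime i = 3 by rewrite unlock.
have -> : \sum_(0 <= i < 6) coprime i 30 = 1 by rewrite unlock.
suff : \sum_(6 <= p < 30 * q.+1) prime p
          <= \sum_(6 <= i < 30 * q.+1) coprime i 30 by lia.
rewrite !big_nat; apply: leq_sum => p /andP[p5 _].
by case: (boolP (prime p)) => // pp; rewrite prime_coprime30.
Qed.

(** * Valuations, smooth parts and factorials *)

Lemma logn_prod (I : finType) (P : pred I) (F : I -> nat) p :
  (forall i, 0 < F i) ->
  logn p (\prod_(i | P i) F i) = \sum_(i | P i) logn p (F i).
Proof.
move=> F_gt0.
suff [] : 0 < \prod_(i | P i) F i
    /\ logn p (\prod_(i | P i) F i) = \sum_(i | P i) logn p (F i) by [].
apply: (big_rec2 (fun a b => 0 < a /\ logn p a = b)); first by rewrite logn1.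
by move=> i a b _ [a_gt0 <-]; rewrite muln_gt0 F_gt0 lognM.
Qed.

Lemma partn_ltn m n :
  0 < n -> n`_[pred p | p < m] = \prod_(0 <= p < m) p ^ logn p n.
Proof.
move=> n_gt0; rewrite (@widen_partn (n + m)) ?leq_addr //.
by rewrite [RHS](big_nat_widen _ _ (n + m).+1) ?leqW ?leq_addl.
Qed.

(** Subtraction is truncated, so [(i - j) + (j - i)] is the distance between [i] and [j]. The two
    factorials come from the [j] below [i] and those above it. *)
Lemma prod_dist_fact m i : i < m ->
  \prod_(0 <= j < m | j != i) ((i - j) + (j - i)) = i`! * (m - i.+1)`!.
Proof.
move=> lt_im; rewrite (@big_cat_nat _ _ _ i) ?(ltnW lt_im) //=; congr (_ * _).
  have -> : \prod_(0 <= j < i | j != i) ((i - j) + (j - i))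
              = \prod_(0 <= j < i) (i - j).
    rewrite big_nat_cond [RHS]big_nat_cond; apply: eq_big => j; first by lia.
    by move=> /andP[] ?; lia.
  elim: i {lt_im} => [|i IHi]; first by rewrite big_geq.
  by rewrite big_nat_recl // factS -IHi subn0.
rewrite big_ltn_cond // eqxx /=.
have -> : \prod_(i.+1 <= j < m | j != i) ((i - j) + (j - i))
            = \prod_(i.+1 <= j < i.+1 + (m - i.+1)) (j - i).
  rewrite subnKC // big_nat_cond [RHS]big_nat_cond.
  by apply: eq_big => j; [lia | move=> /andP[] ?; lia].
elim: (m - i.+1) => [|l IHl]; first by rewrite addn0 big_geq.
by rewrite addnS big_nat_recr ?leq_addr //= IHl factS mulnC; congr (_ * _); lia.
Qed.

Lemma prod_dist_dvdn_fact m (i : 'I_m) :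
  \prod_(j < m | j != i) ((i - j) + (j - i)) %| m`!.
Proof.
have im := ltn_ord i.
have -> : \prod_(j < m | j != i) ((i - j) + (j - i)) = i`! * (m - i.+1)`!.
  by rewrite -prod_dist_fact // big_mkord.
case: m i im => // m i im; rewrite subSS factS dvdn_mull //.
by rewrite -(@bin_fact m i) // dvdn_mull.
Qed.

Lemma fact_leq_expn m : m`! <= m ^ m.
Proof.
elim: m => // m IHm; rewrite factS expnS leq_mul2l /=.
by apply: leq_trans IHm _; case: m => // m; rewrite leq_exp2r.
Qed.

(** * Integers whose pairwise gcds divide the index distances *)

Section SpreadFamily.

Variables (m : nat) (x : 'I_m -> nat).
Hypothesis x_gt0 : forall i, 0 < x i.
Hypothesis gcd_dvd : forall i j, gcdn (x i) (x j) %| (i - j) + (j - i).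

(** Take [i] of maximal valuation. For [j != i] the power of [p] in [x j] also divides [x i], hence
    their gcd, hence the index distance; the product of these distances divides the factorial of
    [m]. *)
Lemma logn_spread_leq p : prime p -> 0 < m ->
  exists i, logn p (\prod_i x i) <= logn p m`! + logn p (x i).
Proof.
move=> pp m_gt0.
have [i max_i] : {i | \max_i logn p (x i) = logn p (x i)}.
  by apply: bigop.eq_bigmax; rewrite card_ord.
exists i; rewrite logn_prod // (bigD1 i) //= addnC leq_add2r.
apply: leq_trans (dvdn_leq_log p (fact_gt0 m) (prod_dist_dvdn_fact i)).
rewrite big_mkcond [X in logn p X]big_mkcond /= logn_prod; last first.
  by move=> j; case: eqVneq => //=; rewrite -val_eqE /=; lia.
apply: leq_sum => j _; case: eqVneq => // ne_ji.
have ne_jiN : (j : nat) != i by [].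
rewrite -pfactor_dvdn //; last by lia.
apply: dvdn_trans (gcd_dvd i j); rewrite dvdn_gcd.
by rewrite !pfactor_dvdn // leqnn andbT -max_i leq_bigmax.
Qed.

Variable V : nat.
Hypothesis x_leq : forall i, x i <= V.

Lemma prod_partn_spread_leq : 0 < m ->
  \prod_i (x i)`_[pred p | p < m] <= m`! * V ^ \sum_(0 <= p < m) prime p.
Proof.
move=> m_gt0.
have X_gt0 : 0 < \prod_i x i by rewrite prodn_gt0.
have -> : \prod_i (x i)`_[pred p | p < m]
            = (\prod_i x i)`_[pred p | p < m].
  suff [] : 0 < \prod_i x i /\ \prod_i (x i)`_[pred p | p < m]
            = (\prod_i x i)`_[pred p | p < m] by [].
  apply: (big_rec2 (fun a b => 0 < b /\ a = b`_[pred p | p < m])).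
    by rewrite partn1.
  by move=> i a b _ [b_gt0 ->]; rewrite muln_gt0 x_gt0 partnM.
rewrite partn_ltn // expn_sum.
(* The boolean exponent charges a factor [V] to primes only. *)
apply: (@leq_trans (\prod_(0 <= p < m) (p ^ logn p m`! * V ^ prime p))).
  apply: leq_prod => p _; have [pp | npp] := boolP (prime p); last first.
    by rewrite /logn (negbTE npp).
  have [i le_i] := logn_spread_leq pp m_gt0.
  apply: leq_trans (_ : p ^ (logn p m`! + logn p (x i)) <= _).
    by rewrite leq_exp2l ?prime_gt1.
  rewrite expnD leq_mul2l expn1 (leq_trans _ (x_leq i)) ?orbT //.
  by rewrite dvdn_leq // pfactor_dvdnn.
rewrite big_split /= leq_mul2r; apply/orP; right.
by rewrite -partn_ltn ?fact_gt0 // dvdn_leq ?fact_gt0 // dvdn_part.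
Qed.

Definition has_large_prime i := has (leq m) (primes (x i)).

(** A term without a prime factor [>= m] equals its [m]-smooth part; any other term has a remaining
    part of at most [V]. *)
Lemma prod_spread_leq : 0 < m ->
  \prod_i x i <=
    m`! * V ^ (\sum_(0 <= p < m) prime p + #|[pred i | has_large_prime i]|).
Proof.
move=> m_gt0.
under eq_bigr do rewrite -(partnC [pred p | p < m] (x_gt0 _)).
rewrite big_split /= expnD mulnA leq_mul ?prod_partn_spread_leq //.
rewrite -sum1_card expn_sum [X in _ <= X]big_mkcond; apply: leq_prod => i _.
rewrite inE expn1; case: ifP => [_|/negbT/hasPn no_p].
  by apply: leq_trans (x_leq i); rewrite dvdn_leq // dvdn_part.
rewrite part_p'nat //; apply/pnatP => // p pp p_dvd.
by rewrite negnK inE /= ltnNge no_p // mem_primes pp x_gt0.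
Qed.

End SpreadFamily.

Lemma many_large_primes q (x : 'I_(30 * q) -> nat) U :
  0 < q -> (forall i, 0 < x i) ->
  (forall i j, gcdn (x i) (x j) %| (i - j) + (j - i)) ->
  (forall i, x i <= 2 * U <= 4 * x i) -> 16 * (30 * q) ^ 3 < U ^ 2 ->
  2 * q < #|[pred i | has_large_prime x i]| + 3.
Proof.
set m := 30 * q => q_gt0 x_gt0 gcd_dvd xU lt_mU; rewrite ltnNge; apply/negP => few.
have U_gt0 : 0 < U by case: U lt_mU {xU}.
have m_gt0 : 0 < m by rewrite muln_gt0.
have := prod_spread_leq x_gt0 gcd_dvd (fun i => proj1 (andP (xU i))) m_gt0.
set e := (\sum_(_ <= _ < _) _ + _) => leP.
have le_e : e <= 10 * q by have := sum_prime_leq q; rewrite -/m /e; lia.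
have leU : U ^ m <= 2 ^ m * \prod_i x i.
  rewrite -[X in U ^ X]card_ord -[X in 2 ^ X]card_ord -!prod_nat_const.
  by rewrite -big_split /=; apply: leq_prod => i _; have := xU i; lia.
have : U ^ m <= 2 ^ m * (m ^ m * (2 * U) ^ (10 * q)).
  apply: leq_trans leU _; rewrite leq_mul2l (leq_trans leP) ?orbT //.
  by rewrite leq_mul ?fact_leq_expn // leq_pexp2l //; lia.
(* Extracting [10 * q]-th roots leaves [U ^ 3 <= 8 * m ^ 3 * (2 * U)], against
   [16 * m ^ 3 < U ^ 2]. *)
have mE : m = 3 * (10 * q) by rewrite mulnA.
rewrite [X in U ^ X]mE [X in 2 ^ X]mE [X in m ^ X]mE.
rewrite !(expnM _ 3) -!expnMn leq_exp2r ?muln_gt0 //.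
by move: (m ^ 3) lt_mU => M; rewrite (expnS U 2); nia.
Qed.

(** * Four-cycles in dense bipartite graphs *)

Lemma sum_sqr_leq (T : finType) (d : T -> nat) :
  (\sum_b d b) ^ 2 <= #|T| * \sum_b d b ^ 2.
Proof.
rewrite -(leq_pmul2l (isT : 0 < 2)) -mulnn big_distrlr /=.
rewrite big_distrr /=; under eq_bigr do rewrite big_distrr.
apply: (@leq_trans (\sum_b \sum_c (d b ^ 2 + d c ^ 2))).
  by apply: leq_sum => b _; apply: leq_sum => c _; apply: (nat_Cauchy _ _).1.
under eq_bigr do rewrite big_split sum_nat_const.
by rewrite big_split sum_nat_const -big_distrr /= addnn mul2n.
Qed.

(** Double counting of triples [(b, c1, c2)] with [b] adjacent to both [c1] and [c2]: their number
    is at least [k ^ 2 / #|T|] by Cauchy-Schwarz. Without a 4-cycle, distinct [c1] and [c2] have at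
    most one common neighbour, which leaves at most [#|T| ^ 2 + k]. *)
Lemma exists_C4 (T : finType) (e : rel T) :
  let k := \sum_b \sum_c (e b c : nat) in
  #|T| ^ 3 + #|T| * k < k ^ 2 ->
  exists b1 b2 c1 c2, [/\ b1 != b2, c1 != c2 &
    [/\ e b1 c1, e b1 c2, e b2 c1 & e b2 c2]].
Proof.
move=> k; rewrite ltnNge => /negP dense.
case: (boolP [exists b1, exists b2, exists c1, exists c2,
  [&& b1 != b2, c1 != c2, e b1 c1, e b1 c2, e b2 c1 & e b2 c2]]).
  case/existsP=> b1 /existsP[b2 /existsP[c1 /existsP[c2]]].
  by case/and5P=> ? ? ? ? /andP[? ?]; exists b1, b2, c1, c2.
move=> noC4; case: dense; apply: leq_trans (sum_sqr_leq _) _.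
rewrite (expnS _ 2) -mulnDr leq_mul2l; apply/orP; right.
under eq_bigr do rewrite -mulnn big_distrlr.
rewrite exchange_big /=; under eq_bigr do rewrite exchange_big.
have -> : #|T| ^ 2 + k
    = \sum_(c1 : T) \sum_(c2 : T) (1 + (c1 == c2) * \sum_b e b c1).
  rewrite /k exchange_big /= -mulnn -sum_nat_const -big_split /=.
  apply: eq_bigr => c1 _; rewrite big_split /= sum1_card.
  rewrite [X in _ = _ + X](bigD1 c1) //= eqxx mul1n.
  rewrite [X in _ = _ + (_ + X)]big1 ?addn0 // => c2.
  by rewrite eq_sym => /negbTE->.
apply: leq_sum => c1 _; apply: leq_sum => c2 _.
have [->|ne_c] := eqVneq c1 c2.
  by rewrite mul1n leqW //; apply: leq_sum => b _; case: (e b c2).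
rewrite mul0n addn0 leqNgt; apply/negP => gt1.
have [b1 eb1] : exists b, e b c1 * e b c2 != 0.
  apply/existsP; apply: contraLR gt1 => /existsPn z.
  by rewrite big1 // => b _; apply/eqP/negbNE/z.
move: gt1; rewrite (bigD1 b1) //=.
have -> : e b1 c1 * e b1 c2 = 1 by move: eb1; case: (e b1 c1); case: (e b1 c2).
rewrite ltnS lt0n => s0.
have [b2 /andP[ne_b eb2]] : exists b, (b != b1) && (e b c1 * e b c2 != 0).
  apply/existsP; apply: contraNT s0 => /existsPn z.
  by rewrite big1 // => b nb; apply/eqP/negbNE; have := z b; rewrite nb.
case/negP: noC4; apply/existsP; exists b1; apply/existsP; exists b2.
apply/existsP; exists c1; apply/existsP; exists c2.
rewrite eq_sym ne_b ne_c; move: eb1 eb2.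
by case: (e b1 c1); case: (e b1 c2); case: (e b2 c1); case: (e b2 c2).
Qed.

Local Open Scope fset_scope.
Local Open Scope ring_scope.

(** * Rationality of [a / d] from a four-cycle *)

Lemma prodset_factors (K : pzSemiRingType) (B : {fset K}) (I : finType)
    (z : I -> K) : (forall i, z i \in prodset B) ->
  exists uv : I -> B * B, forall i, z i = val (uv i).1 * val (uv i).2.
Proof.
move=> zB; apply: (@fin_all_exists _ _ (fun i w => z i = val w.1 * val w.2)).
move=> i; have /imfset2P[b /= bB [b' b'B ->]] := zB i.
by exists ([` bB], [` b'B]).
Qed.

Lemma ap_prodset_rational (K : numFieldType) (B : {fset K}) (a d : K) (k : nat) :
  d != 0 -> {subset arith_prog a d k <= prodset B} ->
  (#|` B| ^ 3 + #|` B| * k < k ^ 2)%N -> exists r : rat, a = d * ratr r.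
Proof.
move=> d_neq0 apB dense.
have [i|uv uvE] := @prodset_factors K B 'I_k (fun i => a + d *+ i).
  by apply: apB; apply/mapP; exists (i : nat); rewrite // mem_iota ltn_ord.
have valI (i j : 'I_k) : a + d *+ i = a + d *+ j -> i = j.
  move/addrI/eqP; rewrite -subr_eq0 -![d *+ _]mulr_natr -mulrBr mulf_eq0.
  by rewrite (negbTE d_neq0) subr_eq0 eqr_nat /= => /eqP/val_inj.
have uv_inj : injective uv by move=> i j e; apply: valI; rewrite !uvE e.
pose e b c := (b, c) \in codom uv.
have [] := @exists_C4 B e.
  have -> : (\sum_b \sum_c (e b c : nat) = k)%N.
    rewrite pair_big /= -[RHS]card_ord -(card_codom uv_inj) -sum1_card.
    by rewrite [RHS]big_mkcond; apply: eq_bigr => -[b c] _; rewrite /e /=; case: ifP.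
  by rewrite -cardfE.
move=> b1 [b2 [c1 [c2 [ne_b ne_c []]]]].
move=> /codomP[i11 e11] /codomP[i12 e12] /codomP[i21 e21] /codomP[i22 e22].
have z11 := uvE i11; have z12 := uvE i12; have z21 := uvE i21; have z22 := uvE i22.
rewrite -e11 /= in z11; rewrite -e12 /= in z12.
rewrite -e21 /= in z21; rewrite -e22 /= in z22.
have ne12 : (i11 : nat) != i12.
  by apply: contraNneq ne_c => /val_inj e0; move: e12; rewrite -e0 -e11 => -[->].
have ne21 : (i11 : nat) != i21.
  by apply: contraNneq ne_b => /val_inj e0; move: e21; rewrite -e0 -e11 => -[->].
(* Both sides are the product of the four vertices of the cycle. *)
have rel : (a + d *+ i11) * (a + d *+ i22) = (a + d *+ i12) * (a + d *+ i21).
  by rewrite z11 z22 z12 z21; ring.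
pose S : int := i11%:Z + i22%:Z - i12%:Z - i21%:Z.
pose Q : int := i11%:Z * i22%:Z - i12%:Z * i21%:Z.
have {}rel : a * S%:~R + d * Q%:~R = 0.
  apply: (mulfI d_neq0); rewrite mulr0.
  move/eqP: rel; rewrite -subr_eq0 => /eqP <-.
  have -> : S%:~R = i11%:R + i22%:R - i12%:R - i21%:R :> K.
    by rewrite /S !intrB intrD.
  have -> : Q%:~R = i11%:R * i22%:R - i12%:R * i21%:R :> K.
    by rewrite /Q intrB !intrM.
  by rewrite -![d *+ _]mulr_natr; ring.
(* If [S] vanished, so would [Q], hence also [(i11 - i12) * (i11 - i21) = i11 * S - Q], although
   distinct edges carry distinct indices. *)
have S_neq0 : S != 0.
  apply/eqP => S0; have Q0 : Q = 0.
    move/eqP: rel; rewrite S0 mulr0 add0r mulf_eq0 (negbTE d_neq0) intr_eq0.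
    by move/eqP.
  have : (i11%:Z - i12%:Z) * (i11%:Z - i21%:Z) = i11%:Z * S - Q.
    by rewrite /S /Q; ring.
  rewrite S0 Q0 mulr0 subr0 => /eqP; rewrite mulf_eq0 !subr_eq0 !eqz_nat.
  by rewrite (negbTE ne12) (negbTE ne21).
have SK : S%:~R != 0 :> K by rewrite intr_eq0.
exists ((- Q)%:~R / S%:~R); rewrite fmorph_div /= !ratr_int intrN.
apply: (mulIf SK); rewrite -mulrA divfK // mulrN.
by apply/eqP; rewrite -addr_eq0 rel.
Qed.

(** * Multiplicative relations in a scaled product set *)

Lemma siegel_pigeonhole (I J : finType) (c : I -> J -> nat) (M : nat) :
  (forall i j, (c i j <= M)%N) -> (0 < M)%N -> (#|J| < #|I|)%N ->
  exists e f : I -> nat, (exists i, e i != f i) /\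
    forall j, (\sum_i e i * c i j = \sum_i f i * c i j)%N.
Proof.
move=> cM M_gt0 ltJI; set N := #|I|.
have N_gt0 : (0 < N)%N by apply: leq_ltn_trans ltJI.
(* With this [T], the at most [(N * M * T).+1 ^ #|J|] image vectors are fewer than the [T.+1 ^ N]
   exponent vectors: [(N * M * T.+1) ^ #|J| = T * T.+1 ^ #|J| < T.+1 ^ #|J|.+1]. *)
pose T := ((N * M) ^ #|J|)%N.
have bound (e : {ffun I -> 'I_T.+1}) j : (\sum_i e i * c i j < (N * M * T).+1)%N.
  rewrite ltnS -mulnA -sum_nat_const; apply: leq_sum => i _.
  by rewrite mulnC leq_mul // -ltnS.
pose Phi (e : {ffun I -> 'I_T.+1}) : {ffun J -> 'I_(N * M * T).+1} :=
  [ffun j => Ordinal (bound e j)].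
have : ~~ injectiveb Phi.
  apply/injectiveP => /leq_card; rewrite !card_ffun !card_ord; apply/negP.
  rewrite -ltnNge; apply: (@leq_trans (T.+1 ^ #|J|.+1)%N); last first.
    by rewrite leq_pexp2l.
  rewrite expnS; apply: (@leq_ltn_trans ((N * M * T.+1) ^ #|J|)%N).
    have [->//|J_gt0] := posnP #|J|.
    by rewrite leq_exp2r // mulnS; nia.
  by rewrite expnMn ltn_mul2r expn_gt0 /= -/T.
case/injectivePn => e [f ne_ef /ffunP eqPhi].
exists (fun i => val (e i)), (fun i => val (f i)); split.
  apply/existsP; apply: contraR ne_ef => /existsPn eq_ef.
  by apply/eqP/ffunP => i; apply/val_inj/eqP/negbNE/eq_ef.
by move=> j; have := congr1 val (eqPhi j); rewrite !ffunE.
Qed.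

Lemma prodset_multiplicative_relation (K : numFieldType) (B : {fset K})
    (I : finType) (x : I -> int) (c : K) :
  c != 0 -> (forall i, c * (x i)%:~R \in prodset B) -> (#|` B|.+1 < #|I|)%N ->
  exists e f : I -> nat, (exists i, e i != f i) /\
    (\prod_i `|x i| ^ e i = \prod_i `|x i| ^ f i)%N.
Proof.
move=> c_neq0 xB ltBI; have [uv uvE] := prodset_factors xB.
(* [Some b] records the multiplicity of [b] in the chosen factorization of [c * x i]. The constant
   coordinate [None] forces the exponents [e] and [f] to have equal sums, so that the powers of [c]
   cancel. *)
pose w i (o : option B) : nat :=
  if o is Some b then (((uv i).1 == b) + ((uv i).2 == b))%N else 1%N.
have [i o|//||e [f [ne_ef eq_ef]]] := @siegel_pigeonhole I (option B) w 2.
- by case: o => //= b; do 2!case: (_ == b).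
- by rewrite card_option -cardfE.
exists e, f; split => //.
have prodE g : c ^+ (\sum_i g i) * \prod_i (x i)%:~R ^+ g i
    = \prod_(b : B) val b ^+ (\sum_i g i * w i (Some b)).
  under [RHS]eq_bigr do rewrite expr_sum.
  rewrite exchange_big expr_sum -big_split; apply: eq_bigr => i _ /=.
  rewrite -exprMn uvE exprMn.
  have powE (v : B) : val v ^+ g i = \prod_(b : B) val b ^+ (g i * (v == b)).
    rewrite (bigD1 v) //= eqxx muln1 big1 ?mulr1 // => b.
    by rewrite eq_sym => /negbTE->; rewrite muln0.
  rewrite !powE -big_split; apply: eq_bigr => b _ /=.
  by rewrite mulnDr exprD.
have sumE g : (\sum_i g i = \sum_i g i * w i None)%N.
  by apply: eq_bigr => i _; rewrite muln1.
have : \prod_i (x i)%:~R ^+ e i = \prod_i (x i)%:~R ^+ f i :> K.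
  apply: (@mulfI _ (c ^+ (\sum_i e i))); first by rewrite expf_neq0.
  rewrite {2}sumE eq_ef -sumE !prodE.
  by apply: eq_bigr => b _; rewrite eq_ef.
have castE g : \prod_i (x i)%:~R ^+ g i = (\prod_i (x i) ^+ g i)%:~R :> K.
  by rewrite rmorph_prod; apply: eq_bigr => i _; rewrite rmorphXn.
rewrite !castE => /intr_inj/(congr1 absz).
have absE g : absz (\prod_i (x i) ^+ g i) = (\prod_i `|x i| ^ g i)%N.
  by rewrite (big_morph absz abszM absz1); apply: eq_bigr => i _; rewrite abszX.
by rewrite !absE.
Qed.

(** In a multiplicative relation with [e i != f i], the valuation at a prime private to [x i] sees
    only that factor and forces [e i = f i]. *)
Lemma private_primes_leq (K : numFieldType) (B : {fset K})
    (I : finType) (x : I -> int) (c : K) :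
  c != 0 -> (forall i, c * (x i)%:~R \in prodset B) -> (forall i, x i != 0) ->
  (forall i, exists p, [/\ prime p, (p %| `|x i|)%N &
     forall j, j != i -> ~~ (p %| `|x j|)%N]) ->
  (#|I| <= #|` B|.+1)%N.
Proof.
move=> c_neq0 xB x_neq0 private; rewrite leqNgt; apply/negP => ltBI.
have [e [f [[i ne_ef] eq_ef]]] := prodset_multiplicative_relation c_neq0 xB ltBI.
have [p [pp p_xi p_xj]] := private i.
have lognE g : logn p (\prod_j `|x j| ^ g j) = (g i * logn p `|x i|)%N.
  rewrite logn_prod => [|j]; last by rewrite expn_gt0 absz_gt0 x_neq0.
  rewrite (bigD1 i) //= lognX big1 ?addn0 // => j ne_ji.
  by rewrite lognX (@logn_coprime p) ?muln0 // prime_coprime // p_xj.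
have /eqP := congr1 (logn p) eq_ef; rewrite !lognE eqn_pmul2r ?(negbTE ne_ef) //.
by rewrite logn_gt0 mem_primes pp p_xi absz_gt0 x_neq0.
Qed.

(** * Windows of integer progressions *)

Lemma coprime_ap (s t : int) (i : nat) :
  coprime `|s| `|t| -> coprime (absz (s + t * i%:Z)%R) `|t|.
Proof.
by rewrite -!coprimezE ![coprimez _ t]coprimez_sym /coprimez addrC mulrC gcdzMDl.
Qed.

(** The gcd divides the difference [t * (i - j)], and it is coprime to [t] because each term is. *)
Lemma gcd_ap_dvdn (s t : int) (i j : nat) : coprime `|s| `|t| ->
  (gcdn (absz (s + t * i%:Z)%R) (absz (s + t * j%:Z)%R) %| (i - j) + (j - i))%N.
Proof.
move=> cop_st; set g := gcdn _ _.
have cop_gt : coprime g `|t|.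
  exact: coprime_dvdl (dvdn_gcdl _ _) (coprime_ap i cop_st).
have : (g%:Z %| (s + t * i%:Z) - (s + t * j%:Z))%Z.
  by rewrite rpredB // dvdzE ?dvdn_gcdl ?dvdn_gcdr.
have -> : (s + t * i%:Z) - (s + t * j%:Z) = t * (i%:Z - j%:Z) by ring.
rewrite dvdzE abszM Gauss_dvdr //.
by have -> : absz (i%:Z - j%:Z) = ((i - j) + (j - i))%N by lia.
Qed.

Lemma ap_window_prodset (K : numFieldType) (B : {fset K}) (c : K) (s t : int)
    (q U : nat) :
  c != 0 -> coprime `|s| `|t| -> (0 < q)%N ->
  (forall i, (i < 30 * q)%N -> c * (s + t * i%:Z)%:~R \in prodset B) ->
  (forall i, (i < 30 * q)%N ->
     (absz (s + t * i%:Z)%R <= 2 * U <= 4 * absz (s + t * i%:Z)%R)%N) ->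
  (16 * (30 * q) ^ 3 < U ^ 2)%N -> (2 * q < #|` B| + 4)%N.
Proof.
move=> c_neq0 cop_st q_gt0 xB xU lt_qU.
have U_gt0 : (0 < U)%N by case: U lt_qU {xU}.
pose x (i : 'I_(30 * q)) := s + t * i%:Z.
have x_gt0 i : (0 < absz (x i))%N by have := xU i (ltn_ord i); rewrite /x; lia.
have gcd_x (i j : 'I_(30 * q)) := gcd_ap_dvdn i j cop_st.
pose I : finType := {i | has_large_prime (fun i => absz (x i)) i}.
have many : (2 * q < #|I| + 3)%N.
  rewrite card_sig.
  exact: many_large_primes q_gt0 x_gt0 gcd_x (fun i => xU i (ltn_ord i)) lt_qU.
suff : (#|I| <= #|` B|.+1)%N by lia.
apply: (@private_primes_leq K B I (fun i => x (val i)) c) => //.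
- by move=> i; apply: xB.
- by move=> i; rewrite -absz_gt0.
move=> i; have /hasP[p] := valP i; rewrite mem_primes => /and3P[pp _ p_xi] le_p.
exists p; split => // j ne_ji; apply/negP => p_xj.
(* This distance is nonzero and smaller than [30 * q <= p], a contradiction. *)
have : (p %| (val i - val j) + (val j - val i))%N.
  by apply: dvdn_trans (gcd_x _ _); rewrite dvdn_gcd p_xi.
have ne : nat_of_ord (val j) != val i by [].
have lti := ltn_ord (val i); have ltj := ltn_ord (val j).
by move/dvdn_leq; lia.
Qed.

Lemma ap_rational_prodset (K : numFieldType) (B : {fset K}) (c : K) (s t : int)
    (k : nat) :
  c != 0 -> 0 < t -> coprime `|s| `|t| ->
  (forall i, (i < k)%N -> c * (s + t * i%:Z)%:~R \in prodset B) ->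
  (k.-1 ^ 2 <= 64 * (30 * (#|` B| + 2)) ^ 3)%N.
Proof.
move=> c_neq0 t_gt0 cop_st xB; rewrite leqNgt; apply/negP => lt_mk.
set q := (#|` B| + 2)%N in lt_mk; pose m := (30 * q)%N.
have m_gt0 : (0 < m)%N by rewrite /m /q; lia.
have le_mk : (4 * m < k)%N.
  rewrite ltnNge; apply/negP => le_km.
  have : (k.-1 ^ 2 <= (4 * m) ^ 2)%N by rewrite leq_exp2r //; lia.
  by move: lt_mk; rewrite -/m; nia.
have tm (i : nat) : (i < m)%N -> 0 <= t * i%:Z <= t * m%:Z by nia.
have tk : t * (4 * m%:Z) <= t * k.-1%:Z by nia.
have kt : k.-1%:Z <= t * k.-1%:Z by nia.
have big_sqr (U : nat) : (k.-1 <= 2 * U)%N -> (16 * m ^ 3 < U ^ 2)%N.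
  move=> leU; have : (k.-1 ^ 2 <= (2 * U) ^ 2)%N by rewrite leq_exp2r.
  by move: lt_mk; rewrite -/m; nia.
suff : (2 * q < #|` B| + 4)%N by rewrite /q; lia.
(* One of the two end terms has absolute value at least [t * k.-1 / 2]; it serves as [U], and the
   window is the [m] terms at that end. As [4 * m <= k.-1], they differ from the end term by at most
   [U / 2]. *)
have [le_s | lt_s] := leP (t * k.-1%:Z) (2 * `|s|).
  apply: (@ap_window_prodset K B c s t q `|s|%N) => //.
  - by rewrite /q; lia.
  - by move=> i lti; apply: xB; rewrite -/m in lti; lia.
  - by move=> i /tm; lia.
  - by apply: big_sqr; lia.
pose l := (k - m)%N.
have lE : t * k.-1%:Z = t * l%:Z + t * m%:Z - t.
  have -> : k.-1%:Z = l%:Z + m%:Z - 1 by lia.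
  by ring.
apply: (@ap_window_prodset K B c (s + t * l%:Z) t q (absz (s + t * k.-1%:Z))) => //.
- exact: coprime_ap.
- by rewrite /q; lia.
- move=> i lti; rewrite -addrA -mulrDr -PoszD; apply: xB.
  by rewrite -/m in lti; lia.
- move=> i lti; have := tm i lti; have := tm m.-1.
  by rewrite lE; lia.
by apply: big_sqr; lia.
Qed.

(** * The length bound over the integers and the reals *)

Lemma ap_prodset (K : numFieldType) (B : {fset K}) (a d : K) (k : nat) :
  d != 0 -> {subset arith_prog a d k <= prodset B} ->
  (k.-1 ^ 2 <= 64 * (30 * (#|` B| + 2)) ^ 3)%N.
Proof.
move=> d_neq0 apB.
(* A progression too short to yield a 4-cycle satisfies the bound directly. *)
have [sparse | dense] := leqP (k ^ 2) (#|` B| ^ 3 + #|` B| * k).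
  by move: #|` B| sparse => n sparse; nia.
have [r aE] := ap_prodset_rational d_neq0 apB dense.
have den_neq0 : (denq r)%:~R != 0 :> K by rewrite intr_eq0 denq_eq0.
apply: (@ap_rational_prodset K B (d / (denq r)%:~R) (numq r) (denq r)).
- by rewrite mulf_neq0 // invr_eq0.
- exact: denq_gt0.
- exact: coprime_num_den.
move=> i lti.
have -> : d / (denq r)%:~R * (numq r + denq r * i%:Z)%:~R = a + d *+ i.
  rewrite aE /ratr intrD intrM -[d *+ i]mulr_natr pmulrn.
  by field.
by apply: apB; apply/mapP; exists i; rewrite // mem_iota.
Qed.

Theorem theorem3 (R : realType) :
  exists2 C : R, 0 < C &
    forall (n : nat) (B : {fset R[i]}), (0 < n)%N -> #|` B| = n ->
    forall (a d : R[i]) (k : nat), d != 0 ->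
      {subset arith_prog a d k <= prodset B} ->
      k%:R <= C * n%:R `^ (3 / 2).
Proof.
(* Here 8 is the root of 64, [90 * n] bounds [30 * (n + 2)], and [90 * 10] bounds the root of
   [90 ^ 3]; the extra 1 pays for passing from [k.-1] to [k], since [w >= 1]. *)
exists (1 + 8 * 90 * 10) => [|n B n_gt0 cardB a d k d_neq0 apB]; first by lra.
have := ap_prodset d_neq0 apB; rewrite cardB => le_k.
set w := n%:R `^ (3 / 2).
have w_ge0 : 0 <= w by exact: powR_ge0.
have w2 : w ^+ 2 = n%:R ^+ 3.
  by rewrite -!powR_mulrn // -powRrM; congr (_ `^ _); field.
have n_ge1 : 1 <= n%:R :> R by rewrite ler1n.
have w_ge1 : 1 <= w.
  by rewrite -(@ler_sqr R) ?nnegrE // w2 expr1n exprn_ege1.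
have le_kw : k.-1%:R <= 8 * 90 * 10 * w.
  rewrite -(@ler_sqr R) ?nnegrE ?mulr_ge0 // exprMn w2 -!natrX.
  have : (k.-1 ^ 2 <= 64 * (90 * n) ^ 3)%N.
    by apply: leq_trans le_k _; rewrite leq_mul2l leq_exp2r //; lia.
  rewrite -(ler_nat R) (natrM _ 64) (natrX _ (90 * n)) (natrM _ 90) (exprMn 3).
  move/le_trans; apply.
  rewrite natrX; set N := n%:R ^+ 3; have : 0 <= N by rewrite exprn_ge0.
  by move=> N_ge0; lra.
have : k%:R <= 1 + k.-1%:R :> R by rewrite nat1r ler_nat; lia.
by lra.
Qed.
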